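(* Let $H$ be a finite dimensional complex Hilbert space, $\lambda\in(0,1)$, and let $f_\lambda(x)=1-\lambda+\lambda x$. Then for any invertible $T\in\mathcal{B}(H)$ with polar decomposition $T=U|T|$, the limit $\lim_{n\to\infty}\Delta_{f_\lambda}^n(T)$ exists, and it does not depend on $\lambda$.
   Context: For an invertible $T$ with polar decomposition $T=U|T|$ ($U$ unitary, $|T|=(T^*T)^{1/2}$), the induced Aluthge transformation with respect to the $\lambda$-weighted arithmetic mean is $\Delta_{f_\lambda}(T)=(1-\lambda)|T|U+\lambda U|T|$ (which is again invertible). Iterates: $\Delta_{f_\lambda}^0(T)=T$, $\Delta_{f_\lambda}^n(T)=\Delta_{f_\lambda}(\Delta_{f_\lambda}^{n-1}(T))$. *)

(* Defs.v *)
From HB Require Import structures.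
From mathcomp Require Import all_boot all_order all_algebra.
From mathcomp Require Import complex.
From mathcomp Require Import all_classical all_reals all_analysis.

Set Implicit Arguments.
Unset Strict Implicit.
Unset Printing Implicit Defensive.

Import Order.TTheory GRing.Theory Num.Theory.
Import numFieldNormedType.Exports.

Local Open Scope classical_set_scope.
Local Open Scope ring_scope.
Local Open Scope complex_scope.

(* A finite-dimensional complex Hilbert space is a finite-dimensional complex
   vector space [H : vectType R[i]] with an inner product
   [dot : {dot H for Num.conj}], linear in its first argument (completeness is
   automatic in finite dimension). Likewise every linear map on [H] is bounded,
   so B(H) is ['End(H)].

   The operators that are uniquely characterized (adjoint, positive square
   root, unitary polar factor) are selected with [xget]; its default value 0 is
   irrelevant as soon as the characterized operator exists. *)
Section operators.
Context (R : realType) (H : vectType R[i]) (dot : {dot H for Num.conj}).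
Implicit Types A B P T U : 'End(H).

Definition invertible_op T : Prop :=
  exists S : 'End(H), (S \o T)%VF = \1%VF /\ (T \o S)%VF = \1%VF.

Definition adjoint A : 'End(H) :=
  xget (0 : 'End(H)) [set B : 'End(H) | forall u v : H, dot (A u) v = dot u (B v)].

(* For the order of [R[i]], [0 <= z] means that z is real and nonnegative;
   hence a positive operator is in particular self-adjoint. *)
Definition positive_op A : Prop := forall u : H, 0 <= dot (A u) u.

Definition unitary_op U : Prop :=
  (adjoint U \o U)%VF = \1%VF /\ (U \o adjoint U)%VF = \1%VF.

Definition sqrt_op A : 'End(H) :=
  xget (0 : 'End(H)) [set P : 'End(H) | positive_op P /\ (P \o P)%VF = A].

Definition abs_op T : 'End(H) := sqrt_op (adjoint T \o T)%VF.

Definition polar_unitary T : 'End(H) :=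
  xget (0 : 'End(H)) [set U : 'End(H) | unitary_op U /\ T = (U \o abs_op T)%VF].

Definition aluthge (lambda : R) T : 'End(H) :=
  (1 - lambda)%:C *: (abs_op T \o polar_unitary T)%VF
  + lambda%:C *: (polar_unitary T \o abs_op T)%VF.

Definition hnorm (u : H) : R := Num.sqrt (complex.Re (dot u u)).

Definition opnorm A : R := sup [set hnorm (A u) | u in [set u | hnorm u <= 1]].

Definition cvg_opnorm (S : nat -> 'End(H)) (L : 'End(H)) : Prop :=
  (fun n => opnorm (S n - L)) @ \oo --> (0 : R).

End operators.

(* Main.v *)
Require Import Defs.
From HB Require Import structures.
From mathcomp Require Import all_boot all_order all_algebra.
From mathcomp Require Import complex.
From mathcomp Require Import all_classical all_reals all_analysis.
From mathcomp Require Import sesquilinear spectral ring lra.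

(** Let T = U P with U unitary and P positive definite. Then
      (1 - l) P U + l U P = U ((1 - l) U^* P U + l P),
    and the second factor is again positive definite. By uniqueness of the
    polar decomposition, the transform therefore keeps the unitary factor U and
    replaces P by its mean with the conjugate U^* P U: the iteration is linear
    in P.

    In an orthonormal basis e of eigenvectors of U, with eigenvalues d_i of
    modulus 1, this linear map multiplies the entry <P e_i, e_j> by
      c_ij = (1 - l) d_i (d_j)^* + l.
    If d_i = d_j then c_ij = 1; otherwise d_i (d_j)^* is a point of the unit
    circle other than 1, and |c_ij| < 1 by strict convexity
    ([sqmod_mean_lt1]). So the n-th iterate of P converges to the matrix
    obtained from P by erasing the entries with d_i <> d_j, i.e. to the
    orthogonal projection of P on the commutant of U, whatever l is.

    Operators are represented by matrices in an orthonormal basis, acting on row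
    vectors on the right. Composition is thus reversed, T = U P becoming
    M = S *m W with S the matrix of P and W that of U. The spectral theorem for
    normal matrices yields the existence and uniqueness of positive square roots
    ([pd_sqrtmx_exists], [psd_sqrtmx_uniq]), hence of the polar factors, and the
    eigenbasis of W. Convergence is first proved for the Frobenius norm, which
    is invariant under unitary changes of basis, and bounds the operator norm
    ([opnorm_hommx_le]). *)

Set Implicit Arguments.
Unset Strict Implicit.
Unset Printing Implicit Defensive.

Import Order.TTheory GRing.Theory Num.Theory.
Import numFieldNormedType.Exports.
Import passmx.
Local Open Scope classical_set_scope.
Local Open Scope ring_scope.
Local Open Scope sesquilinear_scope.

(** * Positive matrices, square roots and polar decomposition *)

Section PositiveMatrices.
Context (C : numClosedFieldType) (n : nat).
Implicit Types (M S X W Q : 'M[C]_n) (u : 'rV[C]_n) (d : 'rV[C]_n).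

(** Positive semidefinite matrices. The order of [C] makes the value of the form
    real, so that such a matrix is Hermitian ([psdmx_herm]). *)
Definition psdmx M := forall u, 0 <= (u *m M *m u^t*) 0 0.

(** Positive definite matrices. *)
Definition pdmx M := forall u, u != 0 -> 0 < (u *m M *m u^t*) 0 0.

Lemma pdmxW M : pdmx M -> psdmx M.
Proof.
move=> Mpd u; have [->|/Mpd/ltW//] := eqVneq u 0.
by rewrite !mul0mx mxE.
Qed.

Lemma pdmx_unit M : pdmx M -> M \in unitmx.
Proof.
move=> Mpd; rewrite -row_free_unit -kermx_eq0; apply/rowV0P => u /sub_kermxP uM0.
by apply: contraTeq isT => /Mpd; rewrite uM0 mul0mx mxE ltxx.
Qed.

Lemma pdmx_scale a M : 0 < a -> pdmx M -> pdmx (a *: M).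
Proof.
by move=> a0 Mpd u /Mpd ?; rewrite -scalemxAr -scalemxAl mxE mulr_gt0.
Qed.

Lemma pdmxD M S : pdmx M -> pdmx S -> pdmx (M + S).
Proof.
move=> Mpd Spd u u0; rewrite mulmxDr mulmxDl mxE.
by rewrite addr_gt0 ?Mpd ?Spd.
Qed.

Lemma pdmx_conj X M : X \in unitmx -> pdmx M -> pdmx (X *m M *m X^t*).
Proof.
move=> Xu Mpd u u0.
have : u *m X != 0.
  by apply: contraNneq u0 => uX0; rewrite -(mulmxK Xu u) uX0 mul0mx.
by move/Mpd; rewrite trmx_mul map_mxM !mulmxA.
Qed.

Lemma diag_mx_form d u :
  (u *m diag_mx d *m u^t*) 0 0 = \sum_i d 0 i * `|u 0 i| ^+ 2.
Proof.
rewrite mul_mx_diag mxE; apply: eq_bigr => i _; rewrite !mxE normCK.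
by rewrite mulrAC mulrC.
Qed.

Lemma pdmx_diag d : (forall i, 0 < d 0 i) -> pdmx (diag_mx d).
Proof.
move=> d0 u u0; rewrite diag_mx_form.
have [i ui0] : exists i, u 0 i != 0.
  apply/existsP; apply: contraNT u0; rewrite negb_exists => /forallP u0.
  by apply/eqP/rowP => j; rewrite mxE; apply/eqP; have := u0 j; rewrite negbK.
rewrite (bigD1 i)//= ltr_wpDr// ?mulr_gt0 ?exprn_gt0 ?normr_gt0//.
by apply: sumr_ge0 => j _; rewrite mulr_ge0 ?exprn_ge0// ltW.
Qed.

Lemma pdmx1 : pdmx 1%:M.
Proof. by rewrite -diag_const_mx; apply: pdmx_diag => i; rewrite mxE. Qed.

(** The diagonal entries of Q M Q^* are the values of the form of M on the rows
    of Q. *)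
Lemma form_row M Q i : (row i Q *m M *m (row i Q)^t*) 0 0 = (Q *m M *m Q^t*) i i.
Proof.
rewrite -row_mul [in RHS]mxE [in LHS]mxE; apply: eq_bigr => j _.
by rewrite !mxE.
Qed.

Lemma normalmx_diagonalize M : M \is normalmx -> exists Q d,
  [/\ Q \is unitarymx, M = Q^t* *m diag_mx d *m Q &
      Q *m M *m Q^t* = diag_mx d].
Proof.
move=> /orthomx_spectralP MQ; exists (spectralmx M), (spectral_diag M).
have Qu := spectral_unitarymx M.
have QM : M = (spectralmx M)^t* *m diag_mx (spectral_diag M) *m spectralmx M.
  by rewrite -invmx_unitary.
split => //; rewrite [in X in _ *m X *m _]QM !mulmxA (unitarymxP Qu) mul1mx.
by rewrite -mulmxA (unitarymxP Qu) mulmx1.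
Qed.

Lemma diag_entry_form Q M d i : Q *m M *m Q^t* = diag_mx d ->
  d 0 i = (row i Q *m M *m (row i Q)^t*) 0 0.
Proof. by move=> E; rewrite form_row E mxE eqxx. Qed.

(** The skew-Hermitian matrix M - M^* is unitarily diagonalizable, and its
    eigenvalues are values of its form, which vanishes because that of M is real. *)
Lemma psdmx_herm M : psdmx M -> M^t* = M.
Proof.
move=> Mpsd; pose K := M - M^t*.
have Kt : K^t* = - K.
  by rewrite /K linearB/= map_mxB trmxCK opprB.
have Knorm : K \is normalmx by apply/normalmxP; rewrite Kt mulmxN mulNmx.
have [Q [d [Qu KE dE]]] := normalmx_diagonalize Knorm.
suff d0 : d = 0.
  by symmetry; apply/eqP; rewrite -subr_eq0 -/K KE d0 linear0 mulmx0 mul0mx.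
apply/rowP => i; rewrite (diag_entry_form _ dE) [RHS]mxE; set u := row i Q.
have := Mpsd u; set z := (u *m M *m u^t*) 0 0 => z0.
have -> : (u *m K *m u^t*) 0 0 = z - z^*.
  rewrite /K mulmxBr mulmxBl mxE; congr (_ + _); rewrite mxE; congr (- _).
  have -> : u *m M^t* *m u^t* = (u *m M *m u^t*)^t*.
    by rewrite !trmx_mul !map_mxM trmxCK mulmxA.
  by rewrite mxE mxE.
by rewrite (CrealP _) ?subrr// ger0_real.
Qed.

(** With D = S - X, one has D S + X D = S^2 - X^2 = 0. On a unit eigenvector u of
    D, with eigenvalue d, this reads d (a + b) = 0, where a and b are the values
    at u of the forms of S and X, whereas d = a - b. Hence d = 0. *)
Lemma psd_sqrtmx_uniq S X : psdmx S -> psdmx X -> S *m S = X *m X -> S = X.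
Proof.
move=> Sp Xp SX; pose D := S - X.
have Dt : D^t* = D by rewrite /D linearB/= map_mxB !psdmx_herm.
have Dn : D \is normalmx by apply/normalmxP; rewrite Dt.
have [Q [d [Qu DE dE]]] := normalmx_diagonalize Dn.
suff d0 : d = 0.
  by apply/eqP; rewrite -subr_eq0 -/D DE d0 linear0 mulmx0 mul0mx.
apply/rowP => i; rewrite [RHS]mxE; have di := diag_entry_form i dE.
set u := row i Q in di.
have uD : u *m D = d 0 i *: u.
  rewrite DE /u -row_mul !mulmxA (unitarymxP Qu) mul1mx.
  apply/rowP => j; rewrite !mxE (bigD1 i)//= big1 => [|k ki].
    by rewrite mxE eqxx addr0.
  by rewrite mxE eq_sym (negPf ki) mul0r.
have Du : D *m u^t* = (d 0 i)^* *: u^t*.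
  by rewrite -[in LHS]Dt -map_mxM -trmx_mul uD linearZ/= map_mxZ.
have := Sp u; set a := (u *m S *m u^t*) 0 0 => a0.
have := Xp u; set b := (u *m X *m u^t*) 0 0 => b0.
have dab : d 0 i = a - b.
  by rewrite di /D mulmxBr mulmxBl mxE; congr (_ + _); rewrite mxE.
have dr : (d 0 i)^* = d 0 i.
  by apply/CrealP; rewrite dab rpredB// ger0_real.
have dab0 : d 0 i * (a + b) = 0.
  have : D *m S + X *m D = 0.
    by rewrite /D mulmxBl mulmxBr SX addrA subrK subrr.
  move/(congr1 (fun Y => (u *m Y *m u^t*) 0 0)).
  rewrite mulmx0 mul0mx [RHS]mxE mulmxDr mulmxDl.
  rewrite !mulmxA uD -!mulmxA Du -!(scalemxAl, scalemxAr) dr mulmxA.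
  by rewrite mulmxA mxE [X in X + _]mxE [X in _ + X]mxE -mulrDr.
have /eqP := dab0; rewrite mulf_eq0 => /orP[/eqP//|].
by rewrite paddr_eq0// => /andP[/eqP a00 /eqP b00]; rewrite dab a00 b00 subrr.
Qed.

Lemma pd_sqrtmx_exists M : pdmx M -> exists2 S, pdmx S & S *m S = M.
Proof.
move=> Mpd; have Mt := psdmx_herm (pdmxW Mpd).
have Mn : M \is normalmx by apply/normalmxP; rewrite Mt.
have [Q [d [Qu ME dE]]] := normalmx_diagonalize Mn.
have d0 i : 0 < d 0 i.
  rewrite (diag_entry_form _ dE) Mpd//; apply/eqP => Q0.
  have /matrixP/(_ i i) := unitarymxP Qu.
  rewrite -[Q *m _]/(Q *m Q^t*) -[Q in Q *m _]mulmx1 -form_row Q0 !mul0mx.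
  by rewrite !mxE eqxx => /esym/eqP; rewrite oner_eq0.
pose s : 'rV[C]_n := map_mx sqrtC d.
exists (Q^t* *m diag_mx s *m Q).
  have := @pdmx_conj (Q^t*) (diag_mx s); rewrite trmxCK; apply.
    by rewrite unitarymx_unit// trmxC_unitary.
  by apply: pdmx_diag => i; rewrite mxE sqrtC_gt0.
rewrite !mulmxA mulmxtVK//.
  rewrite ME; congr (_ *m _); rewrite -mulmxA; congr (_ *m _).
  rewrite mulmx_diag; congr diag_mx; apply/rowP => i.
  by rewrite !mxE -expr2 sqrtCK.
Qed.

Lemma polarmx_exists M : M \in unitmx ->
  exists S W, [/\ pdmx S, W \is unitarymx & M = S *m W].
Proof.
move=> Mu; have MMpd : pdmx (M *m M^t*).
  by have := pdmx_conj Mu pdmx1; rewrite mulmx1.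
have [S Spd SS] := pd_sqrtmx_exists MMpd.
have Su := pdmx_unit Spd; have St := psdmx_herm (pdmxW Spd).
exists S, (invmx S *m M); split=> //; last by rewrite mulKVmx.
apply/unitarymxP; rewrite trmx_mul map_mxM !mulmxA -(mulmxA _ M) -SS.
by rewrite mulmxA mulVmx// mul1mx -{1}St -map_mxM -trmx_mul mulVmx ?trmx1 ?map_mx1.
Qed.

Lemma mulmx_polar S W : psdmx S -> W \is unitarymx ->
  (S *m W) *m (S *m W)^t* = S *m S.
Proof.
move=> Sp Wu; rewrite trmx_mul map_mxM (psdmx_herm Sp) !mulmxA.
by rewrite -(mulmxA S) (unitarymxP Wu) mulmx1.
Qed.

End PositiveMatrices.

(** * The Frobenius norm *)

Section Frobenius.
Context (C : numClosedFieldType) (n : nat).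
Implicit Types (M Q : 'M[C]_n).

Lemma mxtrace_mulmxtE M : \tr (M *m M^t*) = \sum_i \sum_j `|M i j| ^+ 2.
Proof.
apply: eq_bigr => i _; rewrite mxE; apply: eq_bigr => j _.
by rewrite !mxE normCK.
Qed.

(** The operator norm is at most the Frobenius norm: the entries of u M are inner
    products of u with the columns of M. *)
Lemma form_le_frobenius M (u : 'rV[C]_n) :
  (u *m M *m (u *m M)^t*) 0 0 <= (u *m u^t*) 0 0 * \tr (M *m M^t*).
Proof.
have -> : \tr (M *m M^t*) = \sum_j dotmx (row j (M^t*)) (row j (M^t*)).
  rewrite mxtrace_mulC; apply: eq_bigr => j _; rewrite dotmxE !mxE.
  by apply: eq_bigr => i _; rewrite !mxE conjCK.
rewrite mulr_sumr [leLHS]mxE; apply: ler_sum => j _.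
have CS : `|dotmx u (row j (M^t*))| ^+ 2 <=
    dotmx u u * dotmx (row j (M^t*)) (row j (M^t*)).
  exact: (CauchySchwarz (@dotmx C n) u (row j (M^t*))).1.
move: CS.
rewrite -[(u *m u^t*) 0 0]dotmxE; apply: le_trans.
rewrite normCK le_eqVlt; apply/orP; left; apply/eqP.
have -> : dotmx u (row j (M^t*)) = (u *m M) 0 j.
  rewrite dotmxE !mxE; apply: eq_bigr => i _; by rewrite !mxE conjCK.
by congr (_ * _); rewrite mxE mxE.
Qed.

Lemma mxtrace_unitary_conj Q (V : 'M[C]_n) M :
  Q \is unitarymx -> V \is unitarymx ->
  \tr ((Q *m M *m V) *m (Q *m M *m V)^t*) = \tr (M *m M^t*).
Proof.
move=> Qu Vu; rewrite !trmx_mul !map_mxM !mulmxA mulmxtVK//.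
rewrite -!mulmxA mxtrace_mulC -!mulmxA.
have /unitarymxP : Q^t* \is unitarymx by rewrite trmxC_unitary.
by rewrite trmxCK => ->; rewrite mulmx1.
Qed.

End Frobenius.

(** * Squared modulus of complex numbers *)

Section ComplexSquares.
Context (R : realType).
Implicit Types z : R[i].

(** The squared modulus, as an element of [R] rather than [R[i]]. *)
Definition sqmod z : R := complex.Re z ^+ 2 + complex.Im z ^+ 2.

Lemma sqmodE z : `|z| ^+ 2 = ((sqmod z)%:C)%C.
Proof. by rewrite add_Re2_Im2. Qed.

Lemma sqmod_ge0 z : 0 <= sqmod z.
Proof. by rewrite addr_ge0 ?sqr_ge0. Qed.

Lemma sqmodM z1 z2 : sqmod (z1 * z2) = sqmod z1 * sqmod z2.
Proof. by case: z1 z2 => [a b] [c d]; rewrite /sqmod /=; ring. Qed.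

Lemma sqmodX z k : sqmod (z ^+ k) = sqmod z ^+ k.
Proof.
elim: k => [|k IH]; first by rewrite !expr0 /sqmod /=; ring.
by rewrite !exprS sqmodM IH.
Qed.

(** Strict convexity of the unit disc, on the segment from a point of the circle
    to 1. *)
Lemma sqmod_mean_lt1 (lambda : R) z : 0 < lambda < 1 -> `|z| = 1 -> z != 1 ->
  sqmod ((1 - lambda)%:C%C * z + lambda%:C%C) < 1.
Proof.
move=> /andP[l0 l1] z1 zN1.
have : sqmod z = 1.
  by have := sqmodE z; rewrite z1 expr1n => /(congr1 (@complex.Re R)) /= <-.
case: z zN1 {z1} => a b; rewrite eq_complex /= /sqmod /= => abN1 ab1.
have a1 : a < 1.
  rewrite ltNge; apply: contra abN1 => a1.
  have a1' : a = 1 by nra.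
  by rewrite a1' eqxx /=; move: ab1; rewrite a1' => ?; apply/eqP; nra.
rewrite !mul0r !subr0 !addr0.
(* |(1 - l) z + l|^2 = 1 - 2 l (1 - l) (1 - Re z) on the unit circle. *)
have -> : ((1 - lambda) * a + lambda) ^+ 2 + ((1 - lambda) * b) ^+ 2 =
  1 - 2 * lambda * (1 - lambda) * (1 - a) + (1 - lambda) ^+ 2 * (a ^+ 2 + b ^+ 2 - 1).
  ring.
rewrite ab1 subrr mulr0 addr0 gtrBl !mulr_gt0 ?subr_gt0//.
Qed.

End ComplexSquares.

(** * Mean of a matrix with its unitary conjugate *)

Section MeanConjugation.
Context (C : numClosedFieldType) (n : nat).
Implicit Types (S W Q X : 'M[C]_n) (l : C).

(** The effect of the Aluthge transform on the positive factor S, the unitary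
    factor being W. *)
Definition meanconj l W S := (1 - l) *: (W *m S *m W^t*) + l *: S.

Lemma pdmx_meanconj l W S : 0 < l < 1 -> W \is unitarymx ->
  pdmx S -> pdmx (meanconj l W S).
Proof.
move=> /andP[l0 l1] Wu Sp; apply: pdmxD; apply: pdmx_scale; rewrite ?subr_gt0//.
by apply: pdmx_conj => //; exact: unitarymx_unit.
Qed.

Lemma pdmx_iter_meanconj l W S k : 0 < l < 1 -> W \is unitarymx ->
  pdmx S -> pdmx (iter k (meanconj l W) S).
Proof. by move=> l01 Wu Sp; elim: k => //= k; exact: pdmx_meanconj. Qed.

Lemma meanconj_conj l Q W S : Q \is unitarymx ->
  Q *m meanconj l W S *m Q^t* =
  meanconj l (Q *m W *m Q^t*) (Q *m S *m Q^t*).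
Proof.
move=> Qu; rewrite /meanconj mulmxDr mulmxDl -!scalemxAr -!scalemxAl.
congr (_ *: _ + _); rewrite !trmx_mul !map_mxM trmxCK !mulmxA.
by rewrite !mulmxKtV.
Qed.

Lemma iter_meanconj_conj l Q W S k : Q \is unitarymx ->
  Q *m iter k (meanconj l W) S *m Q^t* =
  iter k (meanconj l (Q *m W *m Q^t*)) (Q *m S *m Q^t*).
Proof. by move=> Qu; elim: k => //= k <-; exact: meanconj_conj. Qed.

Lemma iter_meanconj_diag l (d : 'rV[C]_n) X k i j :
  iter k (meanconj l (diag_mx d)) X i j =
  ((1 - l) * (d 0 i * (d 0 j)^*) + l) ^+ k * X i j.
Proof.
elim: k => [|k IH]; first by rewrite expr0 mul1r.
rewrite iterS {1}/meanconj tr_diag_mx map_diag_mx mul_mx_diag mul_diag_mx.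
by rewrite !mxE IH exprS; ring.
Qed.

Lemma unitary_diag_norm (d : 'rV[C]_n) i :
  diag_mx d \is unitarymx -> `|d 0 i| = 1.
Proof.
move=> /unitarymxP; rewrite tr_diag_mx map_diag_mx mulmx_diag.
move/matrixP/(_ i i); rewrite !mxE eqxx !mulr1n -normCK => /eqP.
by rewrite sqrp_eq1 ?normr_ge0// => /eqP.
Qed.

Lemma unitarymx_diagonalize W : W \is unitarymx -> exists Q d,
  [/\ Q \is unitarymx, Q *m W *m Q^t* = diag_mx d & forall i, `|d 0 i| = 1].
Proof.
move=> Wu; have Wn : W \is normalmx.
  by apply/normalmxP; rewrite (unitarymxP Wu); apply/esym/mulmx1C/unitarymxP.
have [Q [d [Qu _ dE]]] := normalmx_diagonalize Wn.
exists Q, d; split => // i; apply: unitary_diag_norm.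
by rewrite -dE !mul_unitarymx// trmxC_unitary.
Qed.

(** The distance from the k-th iterate to a candidate limit can be computed in an
    eigenbasis of the unitary factor. *)
Lemma frobenius_iter_meanconj l Q W S Y (d : 'rV[C]_n) k
    (E := iter k (meanconj l W) S *m W - Q^t* *m Y *m Q *m W)
    (F := iter k (meanconj l (diag_mx d)) (Q *m S *m Q^t*) - Y) :
  Q \is unitarymx -> W \is unitarymx -> Q *m W *m Q^t* = diag_mx d ->
  \tr (E *m E^t*) = \tr (F *m F^t*).
Proof.
move=> Qu Wu dE; suff -> : E = Q^t* *m F *m (Q *m W).
  by rewrite mxtrace_unitary_conj ?trmxC_unitary ?mul_unitarymx.
have QtQ : Q^t* *m Q = 1%:M by apply/mulmx1C/unitarymxP.
rewrite /F -dE -iter_meanconj_conj// mulmxBr mulmxBl !mulmxA QtQ mul1mx.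
by rewrite mulmxKtV.
Qed.

End MeanConjugation.

(** * Orthonormal bases *)

Section OrthonormalBasis.
Context (C : numClosedFieldType) (H : vectType C) (dot : {dot H for Num.conj}).

Lemma orthonormal_span_seq (vs : seq H) :
  exists2 S, orthonormal dot S & (<<vs>> <= <<S>>)%VS.
Proof.
elim: vs => [|v vs [S So sS]]; first by exists [::].
have [X XS [Y [-> _ YS]]] := orthogonal_split dot S v.
have [Y0|Y0] := eqVneq Y 0.
  exists S => //; rewrite Y0 addr0 span_cons.
  by rewrite subv_add sS andbT -memvE.
pose c := (sqrtC (dot Y Y))^-1; have c0 : c != 0.
  by rewrite invr_eq0 sqrtC_eq0 dnorm_eq0.
exists (c *: Y :: S).
  rewrite /orthonormal /=; move/andP: So => [-> ->]; rewrite !andbT /=.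
  rewrite dnormZ normfV exprVn ger0_norm ?sqrt_dnorm_ge0// sqrtCK mulVf ?dnorm_eq0//.
  rewrite eqxx /=; apply/allP => w wS /=.
  by rewrite linearZl_LR /= (orthoPl YS) // mulr0.
have YL : Y \in <<c *: Y :: S>>%VS.
  by have := memvZ c^-1 (memv_span (mem_head (c *: Y) S)); rewrite scalerK.
have SL : (<<S>> <= <<c *: Y :: S>>)%VS by rewrite span_cons addvSr.
rewrite span_cons subv_add (subv_trans sS SL) andbT -memvE memvD//.
exact: (subvP SL).
Qed.

Lemma exists_orthonormal_basis : exists e : (\dim {:H}).-tuple H,
  basis_of {:H} e /\ forall i j : 'I_(\dim {:H}), dot e`_i e`_j = (i == j)%:R.
Proof.
have [S So] := orthonormal_span_seq (vbasis {:H}).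
rewrite (span_basis (vbasisP _)) => fS.
have Sb : basis_of {:H} S.
  by rewrite /basis_of (orthonormal_free So) andbT eqEsubv subvf.
have Ss : size S == \dim {:H} by rewrite (@size_basis _ _ _ _ (in_tuple S) Sb).
exists (Tuple Ss); split => // i j.
have [Su /(_ S`_i S`_j)] := orthonormalP So.
by rewrite !mem_nth ?(eqP Ss)// nth_uniq ?(eqP Ss)// => ->.
Qed.

End OrthonormalBasis.

(** * Operators as matrices in an orthonormal basis *)

Section Operators.
Context (R : realType) (H : vectType R[i]) (dot : {dot H for Num.conj}).
Local Notation n := (\dim {:H}).
Context (e : n.-tuple H) (eb : basis_of {:H} e).
Context (eo : forall i j : 'I_n, dot e`_i e`_j = (i == j)%:R).
Implicit Types (A B T : 'End(H)) (M S W : 'M[R[i]]_n).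

Let hommxZ a M : hommx e e (a *: M) = a *: hommx e e M.
Proof.
have /eqP h0 : hommx e e 0 == 0 by rewrite (hommx_eq0 eb eb).
by have := hommx_linear e e a M 0; rewrite addr0 h0 addr0.
Qed.

Let hommxM M S : hommx e e (M *m S) = (hommx e e S \o hommx e e M)%VF.
Proof. exact: hommx_mul. Qed.

Lemma dot_rVof u v : dot u v = (rVof e u *m (rVof e v)^t*) 0 0.
Proof.
rewrite -{1}[u](rVofK eb) -{1}[v](rVofK eb) /vecof.
rewrite linear_sumlz mxE; apply: eq_bigr => i _.
rewrite linear_sumr (bigD1 i)//= big1 ?addr0 => [|j ji].
  rewrite linearZl_LR linearZr_LR /= eo eqxx mulr1.
  by rewrite !mxE.
by rewrite linearZl_LR linearZr_LR /= eo eq_sym (negPf ji) !mulr0.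
Qed.

Let rVof_hommx M u : rVof e (hommx e e M u) = rVof e u *m M.
Proof. by rewrite (rVof_mul eb eb). Qed.

Lemma dot_hommxl M u v :
  dot (hommx e e M u) v = (rVof e u *m M *m (rVof e v)^t*) 0 0.
Proof. by rewrite dot_rVof rVof_hommx. Qed.

Lemma adjoint_hommx M : adjoint dot (hommx e e M) = hommx e e (M^t*).
Proof.
have adjM u v : dot (hommx e e M u) v = dot u (hommx e e (M^t*) v).
  by rewrite dot_hommxl dot_rVof rVof_hommx trmx_mul map_mxM trmxCK mulmxA.
apply: xget_unique => // B adjB; apply/lfunP => v; apply/eqP.
rewrite -subr_eq0 -(dnorm_eq0 dot) linearBr /= subr_eq0; apply/eqP.
by rewrite -adjB adjM.
Qed.

Lemma positive_op_hommx M : positive_op dot (hommx e e M) <-> psdmx M.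
Proof.
split=> Mp u; last by rewrite dot_hommxl; exact: Mp.
by have := Mp (vecof e u); rewrite dot_hommxl (vecofK eb).
Qed.

Lemma unitary_op_hommx W : unitary_op dot (hommx e e W) <-> W \is unitarymx.
Proof.
rewrite /unitary_op adjoint_hommx -!hommxM -(hommx1 eb).
split => [[/(can_inj (hommxK eb eb)) /unitarymxP //]|/unitarymxP WW].
by split; congr hommx => //; apply: mulmx1C.
Qed.

Lemma sqrt_op_hommx S : psdmx S -> sqrt_op dot (hommx e e (S *m S)) = hommx e e S.
Proof.
move=> Sp; apply: xget_unique => [|X].
  by split; [exact/positive_op_hommx|rewrite hommxM].
rewrite /= -[X](mxofK eb eb) -hommxM => -[/positive_op_hommx Xp].
move=> /(can_inj (hommxK eb eb)) XX.
by rewrite (psd_sqrtmx_uniq Xp Sp XX).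
Qed.

(** Here S need only be semidefinite; the unitary factor is determined when S is
    moreover invertible ([polar_unitary_hommx]). *)
Lemma abs_op_hommx S W : psdmx S -> W \is unitarymx ->
  abs_op dot (hommx e e (S *m W)) = hommx e e S.
Proof.
by move=> Sp Wu; rewrite /abs_op adjoint_hommx -hommxM mulmx_polar// sqrt_op_hommx.
Qed.

Lemma polar_unitary_hommx S W : pdmx S -> W \is unitarymx ->
  polar_unitary dot (hommx e e (S *m W)) = hommx e e W.
Proof.
move=> Sp Wu; apply: xget_unique => [|U].
  rewrite abs_op_hommx//; last exact: pdmxW.
  by split; [exact/unitary_op_hommx|rewrite hommxM].
rewrite /= -[U](mxofK eb eb) (abs_op_hommx (pdmxW Sp) Wu) -hommxM.
move=> [_ /(can_inj (hommxK eb eb)) SWU].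
by rewrite -(mulKmx (pdmx_unit Sp) W) SWU (mulKmx (pdmx_unit Sp)).
Qed.

Lemma aluthge_hommx lambda S W : pdmx S -> W \is unitarymx ->
  aluthge dot lambda (hommx e e (S *m W)) =
  hommx e e (meanconj lambda%:C%C W S *m W).
Proof.
move=> Sp Wu; rewrite /meanconj -(rmorph1 (real_complex R)) -rmorphB.
rewrite /aluthge polar_unitary_hommx// abs_op_hommx//; last exact: pdmxW.
rewrite -!hommxM mulmxDl -!scalemxAl mulmxKtV//.
by rewrite hommx_linear hommxZ; reflexivity.
Qed.

(** The square of the Frobenius norm. *)
Definition frobenius M : R := complex.Re (\tr (M *m M^t*)).

Lemma frobeniusE M : frobenius M = \sum_i \sum_j sqmod (M i j).
Proof.
rewrite /frobenius mxtrace_mulmxtE raddf_sum; apply: eq_bigr => i _.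
by rewrite raddf_sum; apply: eq_bigr => j _; rewrite sqmodE.
Qed.

Lemma hnorm_hommx_le M u : hnorm dot u <= 1 ->
  hnorm dot (hommx e e M u) <= Num.sqrt (frobenius M).
Proof.
move=> u1; apply: ler_wsqrtr.
have := form_le_frobenius M (rVof e u).
rewrite -rVof_hommx -!dot_rVof /frobenius.
have := dnorm_ge0 dot (hommx e e M u).
have := dnorm_ge0 dot u.
have : 0 <= \tr (M *m M^t*).
  rewrite mxtrace_mulmxtE; apply: sumr_ge0 => i _; apply: sumr_ge0 => j _.
  by rewrite exprn_ge0.
move: u1; rewrite /hnorm.
set x := dot u u; set y := dot _ _; set z := \tr _.
case: x y z => [xr xi] [yr yi] [zr zi]; rewrite !lecE /= => x1.
move=> /andP[/eqP -> z0] /andP[/eqP -> x0] /andP[/eqP -> y0] /andP[_].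
move=> /le_trans; apply; rewrite mulr0 subr0 -[leRHS]mul1r ler_wpM2r//.
by rewrite -(sqr_sqrtr x0) exprn_ile1 ?sqrtr_ge0.
Qed.

Lemma opnorm_hommx_le M :
  0 <= opnorm dot (hommx e e M) <= Num.sqrt (frobenius M).
Proof.
set S := [set hnorm dot (hommx e e M u) | u in [set u | hnorm dot u <= 1]]%classic.
have S0 : S 0.
  exists 0 => /=; first by rewrite /hnorm linear0r sqrtr0 ler01.
  by rewrite linear0 /hnorm linear0r sqrtr0.
have Sub : ubound S (Num.sqrt (frobenius M)).
  by move=> _ [u /= u1 <-]; exact: hnorm_hommx_le.
apply/andP; split; last by apply: ge_sup => //; exists 0.
by apply: ub_le_sup => //; exists (Num.sqrt (frobenius M)).
Qed.

Lemma invertible_op_unitmx T : invertible_op T -> mxof e e T \in unitmx.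
Proof.
move=> [V [VT _]]; move/(congr1 (mxof e e)): VT.
by rewrite (mxof_comp e e eb) (mxof1 (basis_free eb)) => /mulmx1_unit[].
Qed.

Let hommxB M S : hommx e e M - hommx e e S = hommx e e (M - S).
Proof.
have := hommx_linear e e (-1) S M.
by rewrite !scaleN1r ![- _ + _]addrC => ->.
Qed.

Lemma iter_aluthge_hommx lambda S W k : 0 < lambda < 1 ->
  pdmx S -> W \is unitarymx ->
  iter k (aluthge dot lambda) (hommx e e (S *m W)) =
  hommx e e (iter k (meanconj lambda%:C%C W) S *m W).
Proof.
move=> l01 Sp Wu; elim: k => [//|k IH].
have l01C : (0 : R[i]) < lambda%:C%C < 1 by rewrite !ltcE /= eqxx.
have Sk := pdmx_iter_meanconj k l01C Wu Sp.
rewrite [LHS]iterS IH (aluthge_hommx _ Sk Wu) [in RHS]iterS.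
reflexivity.
Qed.

Lemma cvg_opnorm_hommx (M_ : nat -> 'M[R[i]]_n) M :
  (fun k => frobenius (M_ k - M)) @ \oo --> 0 ->
  cvg_opnorm dot (fun k => hommx e e (M_ k)) (hommx e e M).
Proof.
move=> M0; rewrite /cvg_opnorm.
apply: (@squeeze_cvgr _ _ _ _ (cst 0) (fun k => Num.sqrt (frobenius (M_ k - M)))).
- by apply: nearW => k; rewrite hommxB; exact: opnorm_hommx_le.
- exact: cvg_cst.
rewrite -[X in _ --> X](@sqrtr0 R).
by apply: continuous_cvg => //; exact: sqrt_continuous.
Qed.

Lemma cvg_frobenius0 (M_ : nat -> 'M[R[i]]_n) :
  (forall i j, (fun k => sqmod (M_ k i j)) @ \oo --> 0) ->
  (fun k => frobenius (M_ k)) @ \oo --> 0.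
Proof.
move=> M0.
have sum0 (f : 'I_n -> nat -> R) : (forall i, f i @ \oo --> 0) ->
    (fun k => \sum_i f i k) @ \oo --> 0.
  move=> f0; elim: (index_enum 'I_n) => [|i s IH].
    by under eq_fun do rewrite big_nil; exact: cvg_cst.
  under eq_fun do rewrite big_cons.
  by have := cvgD (f0 i) IH; rewrite addr0; apply.
under eq_fun do rewrite frobeniusE.
by apply: (sum0) => i; apply: (sum0) => j.
Qed.

(** The convergence theorem for an operator given by its polar decomposition. In
    an eigenbasis of the unitary factor, the positive factor of the limit is
    obtained by erasing the entries between distinct eigenvalues. *)
Lemma cvg_opnorm_polar S W : pdmx S -> W \is unitarymx ->
  exists L, forall lambda, 0 < lambda < 1 ->
  cvg_opnorm dot
    (fun k => iter k (aluthge dot lambda) (hommx e e (S *m W))) L.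
Proof.
move=> Sp Wu.
have [Q [d [Qu dE d1]]] := unitarymx_diagonalize Wu.
set X := Q *m S *m Q^t*.
pose Y : 'M[R[i]]_n := \matrix_(i, j) if d 0 i == d 0 j then X i j else 0.
exists (hommx e e (Q^t* *m Y *m Q *m W)) => lambda l01.
under [X in cvg_opnorm _ X]eq_fun do rewrite iter_aluthge_hommx//.
apply: cvg_opnorm_hommx.
pose Z k := iter k (meanconj lambda%:C%C (diag_mx d)) X.
have frE k : frobenius (iter k (meanconj lambda%:C%C W) S *m W
    - Q^t* *m Y *m Q *m W) = frobenius (Z k - Y).
  by rewrite /frobenius (frobenius_iter_meanconj _ _ _ _ Qu Wu dE).
under eq_fun do rewrite frE.
apply: cvg_frobenius0 => i j.
pose c := (1 - lambda)%:C%C * (d 0 i * (d 0 j)^*) + lambda%:C%C.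
have Zij k : Z k i j = c ^+ k * X i j.
  by rewrite /Z iter_meanconj_diag /c rmorphB rmorph1.
have : Y i j = if d 0 i == d 0 j then X i j else 0 by rewrite mxE.
have [dij|dij] := eqVneq (d 0 i) (d 0 j) => Yij.
  (* The entry is constant along the iteration. *)
  have c1 : c = 1.
    by rewrite /c dij -normCK d1 expr1n mulr1 -rmorphD /= subrK.
  under eq_fun do rewrite mxE Zij [(- Y) _ _]mxE Yij c1 expr1n mul1r subrr.
  rewrite [X in X @ _](_ : _ = cst 0); first exact: cvg_cst.
  by apply/funext => k; rewrite /sqmod /= expr0n addr0.
(* The entry decays geometrically. *)
have c_lt1 : sqmod c < 1.
  apply: sqmod_mean_lt1 => //; first by rewrite normrM norm_conjC !d1 mulr1.
  apply: contra_neq dij => dd1.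
  have dj1 : (d 0 j)^* * d 0 j = 1 by rewrite mulrC -normCK d1 expr1n.
  by rewrite -[LHS]mulr1 -dj1 mulrA dd1 mul1r.
under eq_fun do rewrite mxE Zij [(- Y) _ _]mxE Yij subr0 sqmodM sqmodX.
have c0 : (GRing.exp (sqmod c) : nat -> R) @ \oo --> 0.
  by apply: cvg_expr; rewrite ger0_norm ?sqmod_ge0.
by have := cvgMr_tmp (b := sqmod (X i j)) c0; rewrite mul0r; apply.
Qed.

End Operators.

Theorem theorem5p5 (R : realType) (H : vectType R[i])
    (dot : {dot H for Num.conj}) (T : 'End(H)) :
  invertible_op T ->
  exists L : 'End(H), forall lambda : R, 0 < lambda < 1 ->
    cvg_opnorm dot (fun n : nat => iter n (aluthge dot lambda) T) L.
Proof.
have [e [eb eo]] := exists_orthonormal_basis dot.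
move=> /(invertible_op_unitmx eb) /polarmx_exists [S [W [Sp Wu TE]]].
have [L LT] := cvg_opnorm_polar eb eo Sp Wu.
by exists L; rewrite -TE (mxofK eb eb) in LT.
Qed.
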